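(* Let $A$ be a Noetherian local ring. Then the following hold. (i) The Fitting invariant of a finite-by-flat or a pseudo-finite-by-flat $A$-module is well-defined. That is: if $M,M'$ are finite submodules of an $A$-module $X$ with $X/M$ and $X/M'$ flat, then $M$ and $M'$ have the same Fitting invariant; and if $C,D$ are flat $A$-modules such that $X\oplus C$ and $X\oplus D$ are finite-by-flat, then $X\oplus C$ and $X\oplus D$ have the same Fitting invariant. (ii) Given an inclusion of $A$-modules $X\subseteq Y$ with flat quotient $Y/X$, if $X$ is finite-by-flat (resp. pseudo-finite-by-flat), so is $Y$, and the Fitting invariants of $X$ and $Y$ are the same.
   Context: The Fitting invariant of a finite module $M$ over a Noetherian ring is its first nonzero Fitting ideal ($\operatorname{Fit}_j(M)$ with $j$ minimal such that $\operatorname{Fit}_j(M)\neq 0$). Let $A$ be a Noetherian local ring. An $A$-module $X$ is finite-by-flat if there exists a finite submodule $M$ of $X$ such that $X/M$ is flat; the Fitting invariant of $X$ is defined to be the Fitting invariant of $M$. An $A$-module $X$ is pseudo-finite-by-flat if there exists a flat $A$-module $C$ so that $X\oplus C$ is finite-by-flat; the Fitting invariant of $X$ is defined to be the Fitting invariant of $X\oplus C$. *)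

(* Defs.v *)
From HB Require Import structures.
From mathcomp Require Import all_boot all_algebra.
From mathcomp Require Import boolp classical_sets.
From mathcomp Require Import freeg.

Set Implicit Arguments.
Unset Strict Implicit.
Unset Printing Implicit Defensive.

Import GRing.Theory.

Local Open Scope classical_set_scope.
Local Open Scope quotient_scope.
Local Open Scope ring_scope.

Section Submodules.
Variables (A : comNzRingType) (V : lmodType A).

Record submod (M : submodClosed V) :=
  Submod { submod_val : V; submod_valP : submod_val \in M }.

HB.instance Definition _ (M : submodClosed V) :=
  [isSub for @submod_val M].
HB.instance Definition _ (M : submodClosed V) :=
  [Choice of submod M by <:].
HB.instance Definition _ (M : submodClosed V) :=
  [SubChoice_isSubLmodule of submod M by <:].

Definition in_span (S : set V) (v : V) : Prop :=
  exists (n : nat) (c : 'I_n -> A) (s : 'I_n -> V),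
    (forall i, S (s i)) /\ v = \sum_(i < n) c i *: s i.

Definition span (S : set V) : {pred V} := fun v => `[< in_span S v >].

Lemma spanP S v : reflect (in_span S v) (v \in span S).
Proof. exact: asboolP. Qed.

Lemma span_submod_closed S : submod_closed (span S).
Proof.
split.
  apply/spanP; exists 0%N, (fun=> 0), (fun=> 0); split; first by case.
  by rewrite big_ord0.
move=> a u v /spanP[m [c [s [sS ->]]]] /spanP[n [d [t [tS ->]]]].
apply/spanP; exists (m + n)%N.
exists (fun i => match split i with inl j => a * c j | inr j => d j end).
exists (fun i => match split i with inl j => s j | inr j => t j end).
split=> [i|]; first by case: (split i).
rewrite big_split_ord /= scaler_sumr; congr (_ + _); apply: eq_bigr => i _.
  by rewrite (unsplitK (inl i)) scalerA.
by rewrite (unsplitK (inr i)).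
Qed.

HB.instance Definition _ S :=
  GRing.isSubmodClosed.Build A V (span S) (span_submod_closed S).

Lemma mem_span (S : set V) v : S v -> v \in span S.
Proof.
move=> Sv; apply/spanP; exists 1%N, (fun=> 1), (fun=> v); split=> //.
by rewrite big_ord1 scale1r.
Qed.

End Submodules.

Section Quotients.
Variables (A : comNzRingType) (V : lmodType A).

Definition submod_zmodClosed (M : submodClosed V) : zmodClosed V :=
  HB.pack (GRing.SubmodClosed.sort M)
    (GRing.isZmodClosed.Build V (GRing.SubmodClosed.sort M) (GRing.submod_closedB (submodClosedP M))).

Definition quotmod (M : submodClosed V) : Type :=
  Quotient.quot (submod_zmodClosed M).

HB.instance Definition _ M := GRing.Zmodule.on (quotmod M).

Variable M : submodClosed V.

Definition quotmod_pi (x : V) : quotmod M :=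
  \pi_(Quotient.quot (submod_zmodClosed M)) x.

Definition quotmod_repr (x : quotmod M) : V :=
  repr (x : Quotient.quot (submod_zmodClosed M)).

Lemma quotmod_reprK x : quotmod_pi (quotmod_repr x) = x.
Proof. exact: reprK. Qed.

Lemma quotmod_eq x y : (quotmod_pi x = quotmod_pi y) <-> (x - y \in M).
Proof.
have := @Quotient.idealrBE _ (submod_zmodClosed M) x y.
by rewrite -[_ \in submod_zmodClosed M]/(_ \in M) => ->; split => /eqP.
Qed.

Lemma quotmod_pi_is_zmod_morphism : zmod_morphism quotmod_pi.
Proof. exact: pi_is_zmod_morphism. Qed.

HB.instance Definition _ :=
  GRing.isZmodMorphism.Build V (quotmod M) quotmod_pi
    quotmod_pi_is_zmod_morphism.

Definition quotmod_scale (a : A) (x : quotmod M) : quotmod M :=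
  quotmod_pi (a *: quotmod_repr x).

Lemma quotmod_scaleE a x : quotmod_scale a (quotmod_pi x) = quotmod_pi (a *: x).
Proof.
apply/quotmod_eq; rewrite -scalerBr rpredZ //.
by apply/quotmod_eq; rewrite quotmod_reprK.
Qed.

Lemma quotmod_scaleA a b x :
  quotmod_scale a (quotmod_scale b x) = quotmod_scale (a * b) x.
Proof. by rewrite -[x]quotmod_reprK !quotmod_scaleE scalerA. Qed.

Lemma quotmod_scale1 : left_id 1 quotmod_scale.
Proof. by move=> x; rewrite -[x]quotmod_reprK quotmod_scaleE scale1r. Qed.

Lemma quotmod_scaleDr : right_distributive quotmod_scale +%R.
Proof.
move=> a x y; rewrite -[x]quotmod_reprK -[y]quotmod_reprK -raddfD.
by rewrite !quotmod_scaleE scalerDr raddfD.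
Qed.

Lemma quotmod_scaleDl x : {morph quotmod_scale^~ x : a b / a + b}.
Proof.
move=> a b; rewrite -[x]quotmod_reprK !quotmod_scaleE scalerDl.
by rewrite raddfD.
Qed.

HB.instance Definition _ :=
  GRing.Zmodule_isLmodule.Build A (quotmod M)
    quotmod_scaleA quotmod_scale1 quotmod_scaleDr quotmod_scaleDl.

Lemma quotmod_pi_is_scalable : scalable quotmod_pi.
Proof. by move=> a x; rewrite -quotmod_scaleE. Qed.

HB.instance Definition _ :=
  GRing.isScalable.Build A V (quotmod M) *:%R quotmod_pi
    quotmod_pi_is_scalable.

Variables (W : lmodType A) (f : {linear V -> W}).

Definition quotmod_lift (x : quotmod M) : W := f (quotmod_repr x).

Hypothesis fM : {in M, forall x, f x = 0}.

Lemma quotmod_liftE x : quotmod_lift (quotmod_pi x) = f x.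
Proof.
apply/eqP; rewrite -subr_eq0 -raddfB /=; apply/eqP/fM.
by apply/quotmod_eq; rewrite quotmod_reprK.
Qed.

Lemma quotmod_lift_is_linear : linear quotmod_lift.
Proof.
move=> a x y; rewrite -[x]quotmod_reprK -[y]quotmod_reprK -linearP.
by rewrite !quotmod_liftE linearP.
Qed.

End Quotients.

(* The tensor product: the free module on the pairs (x, y), divided by the
   bilinearity relations. *)
Section Tensor.
Variables (A : comNzRingType) (N M : lmodType A).
Local Notation K := (N * M)%type.
Local Notation F := {freeg K / A}.

Inductive tensor_relation : F -> Prop :=
| tensor_relDl x x' y : tensor_relation (<<(x + x', y)>> - <<(x, y)>> - <<(x', y)>>)
| tensor_relDr x y y' : tensor_relation (<<(x, y + y')>> - <<(x, y)>> - <<(x, y')>>)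
| tensor_relZl a x y : tensor_relation (<<(a *: x, y)>> - a *: <<(x, y)>>)
| tensor_relZr a x y : tensor_relation (<<(x, a *: y)>> - a *: <<(x, y)>>).

Definition tensor : Type := quotmod (span tensor_relation).

HB.instance Definition _ := GRing.Lmodule.on tensor.

Definition tens (x : N) (y : M) : tensor :=
  quotmod_pi (span tensor_relation) <<(x, y)>>.

Definition bilinear_map (P : lmodType A) (b : N -> M -> P) : Prop :=
  (forall y, linear (b^~ y)) /\ (forall x, linear (b x)).

Lemma tens_bilinear : bilinear_map tens.
Proof.
have piE D D' : tensor_relation (D - D') ->
    quotmod_pi (span tensor_relation) D = quotmod_pi _ D'.
  by move=> /mem_span DD'; apply/quotmod_eq.
split=> [y a x x'|x a y y'].
  rewrite /tens.
  rewrite (piE _ (<<(a *: x, y)>> + <<(x', y)>>)) ?opprD ?addrA; last first.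
    exact: tensor_relDl.
  by rewrite raddfD /= (piE _ _ (tensor_relZl a x y)) linearZ.
rewrite /tens.
rewrite (piE _ (<<(x, a *: y)>> + <<(x, y')>>)) ?opprD ?addrA; last first.
  exact: tensor_relDr.
by rewrite raddfD /= (piE _ _ (tensor_relZr a x y)) linearZ.
Qed.

Section Lift.
Variables (P : lmodType A) (b : N -> M -> P).

Definition free_lift : F -> P := fglift (fun p => b p.1 p.2).

Lemma free_liftU k x y : free_lift << k *g (x, y) >> = k *: b x y.
Proof. exact: liftU. Qed.

Lemma free_lift_is_zmod_morphism : zmod_morphism free_lift.
Proof. exact: lift_is_additive. Qed.

HB.instance Definition _ :=
  GRing.isZmodMorphism.Build F P free_lift free_lift_is_zmod_morphism.

Lemma free_lift_is_scalable : scalable free_lift.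
Proof.
move=> c D; transitivity (c *: free_lift (\sum_(z <- dom D) << coeff z D *g z >>)).
  rewrite [c *: D]/(fgscale c D) /fgscale !raddf_sum.
  by apply: eq_bigr => -[x y] _; rewrite /= !free_liftU scalerA.
by rewrite freeg_sumE.
Qed.

HB.instance Definition _ :=
  GRing.isScalable.Build A F P *:%R free_lift free_lift_is_scalable.

Definition tensor_lift : tensor -> P := quotmod_lift free_lift.

Hypothesis bb : bilinear_map b.

Lemma free_lift_span : {in span tensor_relation, forall D, free_lift D = 0}.
Proof.
case: bb => bl br D /spanP[n [c [s [sS ->]]]].
rewrite raddf_sum big1 // => i _ /=; rewrite linearZ /=.
have blD x x' y : b (x + x') y = b x y + b x' y.
  by have := bl y 1 x x'; rewrite !scale1r.
have brD x y y' : b x (y + y') = b x y + b x y'.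
  by have := br x 1 y y'; rewrite !scale1r.
have bl0 y : b 0 y = 0 by apply: (addrI (b 0 y)); rewrite -blD !addr0.
have br0 x : b x 0 = 0 by apply: (addrI (b x 0)); rewrite -brD !addr0.
have blZ a x y : b (a *: x) y = a *: b x y.
  by have := bl y a x 0; rewrite bl0 !addr0.
have brZ a x y : b x (a *: y) = a *: b x y.
  by have := br x a y 0; rewrite br0 !addr0.
suff -> : free_lift (s i) = 0 by rewrite scaler0.
case: (sS i) => [x x' y|x y y'|a x y|a x y];
  rewrite !raddfB /= ?[free_lift (_ *: _)]linearZ /= !free_liftU !scale1r.
- by rewrite blD -addrA -opprD subrr.
- by rewrite brD -addrA -opprD subrr.
- by rewrite blZ subrr.
- by rewrite brZ subrr.
Qed.

Lemma tensor_liftE x y : tensor_lift (tens x y) = b x y.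
Proof.
rewrite /tensor_lift /tens quotmod_liftE; last exact: free_lift_span.
by rewrite /= free_liftU scale1r.
Qed.

Lemma tensor_lift_is_linear : linear tensor_lift.
Proof. exact/quotmod_lift_is_linear/free_lift_span. Qed.

End Lift.

Lemma tensor_hom_ext (P : lmodType A) (f g : {linear tensor -> P}) :
  (forall x y, f (tens x y) = g (tens x y)) -> f =1 g.
Proof.
move=> fg t; rewrite -[t]quotmod_reprK -(freeg_sumE (quotmod_repr t)).
rewrite !raddf_sum /=; apply: eq_bigr => -[x y] _.
set k := coeff _ _; have -> : << k *g (x, y) >> = k *: << (x, y) >> :> F.
  by apply/eqP/freeg_eqP => z; rewrite coeffZ !coeffU mul1r.
by rewrite !linearZ /= fg.
Qed.

End Tensor.

Section TensorMap.
Variables (A : comNzRingType) (N N' M : lmodType A) (f : {linear N -> N'}).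

Lemma tensor_map_bilinear :
  bilinear_map (fun (x : N) (y : M) => tens (f x) y).
Proof.
have [bl br] := @tens_bilinear A N' M.
by split=> [y a x x'|x]; [rewrite linearP; apply: bl | apply: br].
Qed.

Definition tensor_map : tensor N M -> tensor N' M :=
  tensor_lift (fun x y => tens (f x) y).

HB.instance Definition _ :=
  GRing.isLinear.Build A (tensor N M) (tensor N' M) *:%R tensor_map
    (tensor_lift_is_linear tensor_map_bilinear).

Lemma tensor_mapE x y : tensor_map (tens x y) = tens (f x) y.
Proof. exact/tensor_liftE/tensor_map_bilinear. Qed.

End TensorMap.

Section Modules.
Variable A : comNzRingType.

Definition flat (M : lmodType A) : Prop :=
  forall (N N' : lmodType A) (f : {linear N -> N'}),
    injective f -> injective (@tensor_map A N N' M f).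

Definition generates (M : lmodType A) (n : nat) (x : 'I_n -> M) : Prop :=
  forall y, exists c : 'I_n -> A, y = \sum_(i < n) c i *: x i.

Definition finite_module (M : lmodType A) : Prop :=
  exists (n : nat) (x : 'I_n -> M), generates x.

(* Ideals of A are the submodules of the regular module A^o. *)
Definition noetherian : Prop :=
  forall I : submodClosed A^o, finite_module (submod I).

Definition maximal_ideal (m : submodClosed A^o) : Prop :=
  1 \notin m /\
  forall I : submodClosed A^o, {subset m <= I} -> 1 \notin I -> I =i m.

Definition local_ring : Prop :=
  exists2 m : submodClosed A^o, maximal_ideal m &
    forall m' : submodClosed A^o, maximal_ideal m' -> m' =i m.

(* The minors of size n - j of the matrix, with infinitely many rows in
   general, whose rows are all the relations between x_0, ..., x_(n-1).  For
   n <= j the only such minor is the empty one, whose value is 1. *)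
Definition fitting_minors (M : lmodType A) (n : nat) (x : 'I_n -> M)
    (j : nat) : set A^o :=
  [set a | exists (B : 'M[A]_(n - j, n)) (g : 'I_(n - j) -> 'I_n),
     (forall k, \sum_(i < n) B k i *: x i = 0) /\ a = \det (colsub g B)].

(* By Fitting's lemma, the ideal spanned by the minors does not depend on the
   finite generating family x; the union over all choices of x is therefore
   this ideal.  It is empty if M is not finite. *)
Definition fitting_ideal (M : lmodType A) (j : nat) : set A :=
  [set a | exists (n : nat) (x : 'I_n -> M),
     generates x /\ in_span (fitting_minors x j) a].

Definition fitting_invariant (M : lmodType A) : set A :=
  [set a | exists j : nat,
     [/\ fitting_ideal M j <> [set 0],
         forall i : nat, (i < j)%N -> fitting_ideal M i = [set 0]
       & fitting_ideal M j a]].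

Definition finite_with_flat_quotient (X : lmodType A) (M : submodClosed X) :
    Prop :=
  finite_module (submod M) /\ flat (quotmod M).

Definition finite_by_flat (X : lmodType A) : Prop :=
  exists M : submodClosed X, finite_with_flat_quotient M.

(* A relation rather than a function of X: I depends a priori on the choice of
   M, and below also on the choice of the flat module C. *)
Definition fbf_fitting_invariant (X : lmodType A) (I : set A) : Prop :=
  exists2 M : submodClosed X,
    finite_with_flat_quotient M & I = fitting_invariant (submod M).

Definition pseudo_finite_by_flat (X : lmodType A) : Prop :=
  exists2 C : lmodType A, flat C & finite_by_flat (X * C)%type.

Definition pfbf_fitting_invariant (X : lmodType A) (I : set A) : Prop :=
  exists2 C : lmodType A, flat C & fbf_fitting_invariant (X * C)%type I.

End Modules.

(* Main.v *)
Require Import Defs.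
From HB Require Import structures.
From mathcomp Require Import freeg.
From mathcomp Require Import all_boot all_algebra.
From mathcomp Require Import boolp classical_sets.
From mathcomp Require Import perm zify.

(* Flatness of V/P is used in equational form: a linear system satisfied modulo
   P by a family z is explained by a factorization z = C y modulo P through a
   matrix C killed by the coefficients of the system.  Let x and y be finite
   families in W whose spans have flat quotients, and suppose that the
   coefficients of the relations between the x_i are nonunits.  Let B x = 0.
   Modulo matrices killed by B, the criterion for the span of y gives
   x = c y, so that R = B c is a matrix of relations of y, and the criterion
   for the span of x then gives y = c' x modulo matrices killed by R.  A third
   application yields a matrix G of relations of x with B (1 - G) = R c'.  As A
   is local, 1 - G is invertible, so B = R C for some C, and by Cauchy-Binet the
   minors of the relations of x lie in the ideal generated by those of y.  By
   symmetry, minimal generators of two finite submodules with flat quotients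
   have the same ideals of minors of relations.  All the other claims reduce to
   this comparison by embedding the modules in question, with flat cokernels,
   in a common one. *)

Set Implicit Arguments.
Unset Strict Implicit.
Unset Printing Implicit Defensive.

Import GRing.Theory.

Local Open Scope classical_set_scope.
Local Open Scope ring_scope.

(** * Ideals of minors of relations *)

Section Action.
Variables (A : comNzRingType) (V : lmodType A).

Definition act (p n : nat) (B : 'M[A]_(p, n)) (x : 'I_n -> V) (k : 'I_p) : V :=
  \sum_(i < n) B k i *: x i.

Lemma act_mulmx p n q (B : 'M[A]_(p, n)) (C : 'M_(n, q)) (x : 'I_q -> V) k :
  act (B *m C) x k = act B (act C x) k.
Proof.
rewrite /act; under eq_bigr => j _ do rewrite mxE scaler_suml.
rewrite exchange_big /=; apply: eq_bigr => i _.
by rewrite scaler_sumr; apply: eq_bigr => j _; rewrite scalerA.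
Qed.

Lemma actBl p n (B C : 'M[A]_(p, n)) (x : 'I_n -> V) k :
  act (B - C) x k = act B x k - act C x k.
Proof. by rewrite /act -sumrB; apply: eq_bigr => i _; rewrite !mxE scalerBl. Qed.

Lemma actBr p n (B : 'M[A]_(p, n)) (x y : 'I_n -> V) k :
  act B (fun i => x i - y i) k = act B x k - act B y k.
Proof. by rewrite /act -sumrB; apply: eq_bigr => i _; rewrite scalerBr. Qed.

Lemma act1 n (x : 'I_n -> V) k : act 1%:M x k = x k.
Proof.
rewrite /act (bigD1 k) //= mxE eqxx scale1r big1 ?addr0 // => i ik.
by rewrite mxE eq_sym (negPf ik) scale0r.
Qed.

Lemma act0 p n (x : 'I_n -> V) k : act (0 : 'M[A]_(p, n)) x k = 0.
Proof. by rewrite /act big1 // => i _; rewrite mxE scale0r. Qed.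

Lemma act0r p n (B : 'M[A]_(p, n)) k : act B (fun=> 0 : V) k = 0.
Proof. by rewrite /act big1 // => i _; rewrite scaler0. Qed.

Lemma eq_act p n (B : 'M[A]_(p, n)) (x y : 'I_n -> V) k :
  x =1 y -> act B x k = act B y k.
Proof. by move=> xy; apply: eq_bigr => i _; rewrite xy. Qed.

Definition catf (T : Type) (m n : nat) (x : 'I_m -> T) (y : 'I_n -> T)
    (i : 'I_(m + n)) : T :=
  match split i with inl j => x j | inr j => y j end.

Lemma act_row_mx p m n (B : 'M[A]_(p, m)) (C : 'M_(p, n))
    (x : 'I_m -> V) (y : 'I_n -> V) k :
  act (row_mx B C) (catf x y) k = act B x k + act C y k.
Proof.
rewrite /act big_split_ord /=; congr (_ + _); apply: eq_bigr => i _.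
  by rewrite row_mxEl /catf (unsplitK (inl i)).
by rewrite row_mxEr /catf (unsplitK (inr i)).
Qed.

Lemma in_span0 (S : set V) : in_span S 0.
Proof. exact/spanP/rpred0. Qed.

Lemma in_spanS (S : set V) v : S v -> in_span S v.
Proof. by move=> /mem_span/spanP. Qed.

Lemma in_spanZ (S : set V) a v : in_span S v -> in_span S (a *: v).
Proof. by move=> /spanP ?; apply/spanP/rpredZ. Qed.

Lemma in_span_sum (S : set V) (I : Type) (r : seq I) (P : pred I) (F : I -> V) :
  (forall i, P i -> in_span S (F i)) -> in_span S (\sum_(i <- r | P i) F i).
Proof.
by move=> SF; apply/spanP/rpred_sum => i /SF /spanP.
Qed.

Lemma in_span_min (S T : set V) v :
  (forall w, S w -> in_span T w) -> in_span S v -> in_span T v.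
Proof.
move=> ST [n [c [s [sS ->]]]]; apply: in_span_sum => i _.
exact/in_spanZ/ST.
Qed.

End Action.

Lemma act_linear (A : comNzRingType) (V W : lmodType A) (f : {linear V -> W})
    p n (B : 'M[A]_(p, n)) x k :
  f (act B x k) = act B (f \o x) k.
Proof. by rewrite linear_sum; apply: eq_bigr => i _; rewrite linearZ. Qed.

Section Minors.
Variables (A : comNzRingType).

(** A weak form of Cauchy-Binet: expanding the Leibniz formula gives a sum over all maps [f], not
    only the increasing ones. This suffices for membership in an ideal of minors. *)
Lemma det_mulmx_span k n (B : 'M[A]_(k, n)) (C : 'M[A]_(n, k)) :
  \det (B *m C) = \sum_(f : {ffun 'I_k -> 'I_n})
     (\prod_i C (f i) i) * \det (colsub f B).
Proof.
have E (s : 'S_k) : \prod_i (B *m C)^T i (s i) =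
    \sum_(f : {ffun 'I_k -> 'I_n}) \prod_i (B (s i) (f i) * C (f i) i).
  rewrite -(bigA_distr_bigA (fun i j => B (s i) j * C j i)) /=.
  by apply: eq_bigr => i _; rewrite !mxE.
transitivity (\sum_(f : {ffun 'I_k -> 'I_n})
    (\prod_i C (f i) i) * \det (colsub f B)^T); last first.
  by apply: eq_bigr => f _; rewrite det_tr.
rewrite -det_tr {1}/determinant.
under eq_bigr => s _ do rewrite E big_distrr /=.
rewrite exchange_big; apply: eq_bigr => f _.
rewrite big_distrr; apply: eq_bigr => s _ /=.
rewrite big_split /= [RHS]mulrCA; congr (_ * _); rewrite mulrC; congr (_ * _).
by apply: eq_bigr => i _; rewrite !mxE.
Qed.

Lemma det_colsub_eq0 k n (B : 'M[A]_(k, n)) (g : 'I_k -> 'I_n) :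
  ~ injective g -> \det (colsub g B) = 0.
Proof.
move=> /injectiveP/injectivePn[i1 [i2 i12 gi]].
by rewrite -det_tr (determinant_alternate i12) // => j; rewrite !mxE gi.
Qed.

Variable (V : lmodType A).

Definition relation n (x : 'I_n -> V) p (B : 'M[A]_(p, n)) : Prop :=
  forall k, act B x k = 0.

Definition rel_minors n (x : 'I_n -> V) (k : nat) : set A^o :=
  [set a | exists (B : 'M[A]_(k, n)) (g : 'I_k -> 'I_n),
     relation x B /\ a = \det (colsub g B)].

Definition minor_ideal n (x : 'I_n -> V) (k : nat) : set A^o :=
  in_span (rel_minors x k).

Lemma relation_rowsub n (x : 'I_n -> V) p q (B : 'M[A]_(p, n))
    (h : 'I_q -> 'I_p) : relation x B -> relation x (rowsub h B).
Proof.
by move=> xB k; rewrite -[RHS](xB (h k)); apply: eq_bigr => i _; rewrite mxE.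
Qed.

(** Laplace expansion along the first column: deleting a row from a matrix of relations leaves a
    matrix of relations. *)
Lemma minor_idealS n (x : 'I_n -> V) k a :
  minor_ideal x k.+1 a -> minor_ideal x k a.
Proof.
apply: in_span_min => {a} a [B [g [xB ->]]].
rewrite (expand_det_col _ ord0); apply: in_span_sum => i _.
rewrite /cofactor mulrA; apply: in_spanZ; apply: in_spanS.
exists (rowsub (lift i) B), (g \o lift ord0); split.
  exact: relation_rowsub.
by congr (\det _); apply/matrixP => u v; rewrite !mxE.
Qed.

Lemma minor_ideal_leq n (x : 'I_n -> V) k l a :
  (k <= l)%N -> minor_ideal x l a -> minor_ideal x k a.
Proof.
move=> /subnK <-; elim: (l - k)%N => //= m IH.
by rewrite addSn => /minor_idealS.
Qed.

Lemma minor_ideal0 n (x : 'I_n -> V) : minor_ideal x 0 1.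
Proof.
apply: in_spanS; exists 0, (fun i : 'I_0 => False_rect _ (notF (ltn_ord i))).
by split; [move=> k; rewrite act0 | rewrite det_mx00].
Qed.

Lemma minor_ideal_gt n (x : 'I_n -> V) k a :
  (n < k)%N -> minor_ideal x k a -> a = 0.
Proof.
move=> nk [p [c [s [sS ->]]]]; apply: big1 => i _.
have [B [g [_ ->]]] := sS i; apply: (etrans _ (scaler0 _ _)); congr (_ *: _).
apply: det_colsub_eq0 => /leq_card.
by rewrite !card_ord leqNgt nk.
Qed.

End Minors.

Lemma minor_ideal_factor (A : comNzRingType) (V W : lmodType A) n m
    (x : 'I_n -> V) (y : 'I_m -> W) k :
  (forall B : 'M[A]_(k, n), relation x B ->
     exists (R : 'M_(k, m)) (C : 'M_(m, n)), relation y R /\ B = R *m C) ->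
  forall a, minor_ideal x k a -> minor_ideal y k a.
Proof.
move=> fact a; apply: in_span_min => {a} a [B [g [xB ->]]].
have [R [C [yR ->]]] := fact B xB.
have -> : colsub g (R *m C) = R *m colsub g C.
  by apply/matrixP => i j; rewrite !mxE; apply: eq_bigr => l _; rewrite !mxE.
rewrite det_mulmx_span; apply: in_span_sum => f _; apply: in_spanZ.
by apply: in_spanS; exists R, f.
Qed.

(* After the column operation that subtracts [a m] times column [i] from column
   [m], the other columns form a relation matrix of the smaller family; expanding
   a minor along column [i] then leaves minors of that matrix. *)
Lemma minor_ideal_remove (A : comNzRingType) (V : lmodType A) n
    (x : 'I_n.+1 -> V) (i : 'I_n.+1) (a : 'I_n -> A) k c :
  x i = \sum_(l < n) a l *: x (lift i l) ->
  minor_ideal x k.+1 c -> minor_ideal (x \o lift i) k c.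
Proof.
move=> xi; apply: in_span_min => {}c [B [g [xB ->]]].
(* The value 0 at [i] keeps column [i] fixed, so that [N] undoes the passage from [B] to [C]. *)
pose a' m := if unlift i m is Some l then a l else 0.
pose C : 'M[A]_(k.+1, n.+1) := \matrix_(u, m) (B u m + B u i * a' m).
pose N : 'M[A]_n.+1 := \matrix_(l, m) ((l == m)%:R - (l == i)%:R * a' m).
have a'i : a' i = 0 by rewrite /a' unlift_none.
have BC : B = C *m N.
  apply/matrixP => u m; rewrite mxE.
  under eq_bigr => l _ do rewrite !mxE mulrBr.
  rewrite sumrB (bigD1 m) //= eqxx mulr1 big1; last first.
    by move=> l /negPf ->; rewrite mulr0.
  rewrite [X in _ - X](bigD1 i) //= eqxx mul1r [X in _ - (_ + X)]big1; last first.
    by move=> l /negPf ->; rewrite mul0r mulr0.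
  by rewrite a'i mulr0 !addr0 addrK.
have xC : relation (x \o lift i) (colsub (lift i) C).
  move=> u; rewrite -[RHS](xB u) /act [RHS](bigD1_ord i) //= xi scaler_sumr.
  rewrite -big_split; apply: eq_bigr => l _ /=.
  by rewrite !mxE /a' liftK scalerDl addrC scalerA.
have -> : colsub g B = C *m colsub g N.
  rewrite {1}BC; apply/matrixP => u v; rewrite !mxE.
  by apply: eq_bigr => l _; rewrite !mxE.
rewrite det_mulmx_span; apply: in_span_sum => f _; apply: in_spanZ.
have [f_inj|/det_colsub_eq0 ->] := pselect (injective f); last exact: in_span0.
(* [j0] is the position of column [i] among the chosen ones. If [i] is not chosen, any position
   serves, since the expansion then only has to lower the size. *)
have [j0 fj0] : exists j0, forall l, f (lift j0 l) != i.
  have [[j0 fj0]|fi] := pselect (exists j, f j = i); last first.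
    by exists ord0 => l; apply/eqP => fl; apply: fi; exists (lift ord0 l).
  exists j0 => l; apply/eqP; rewrite -fj0 => /f_inj/eqP.
  by rewrite eq_sym (negPf (neq_lift _ _)).
have /fin_all_exists[h hE] l : exists h, f (lift j0 l) = lift i h.
  by have := fj0 l; rewrite eq_sym => /unlift_some[h]; exists h.
rewrite (expand_det_col _ j0); apply: in_span_sum => u _.
rewrite /cofactor mulrA; apply: in_spanZ; apply: in_spanS.
exists (rowsub (lift u) (colsub (lift i) C)), h; split.
  exact: relation_rowsub.
by congr (\det _); apply/matrixP => v l; rewrite !mxE hE.
Qed.

(** * Fitting ideals over a local ring *)

Section LocalRing.
Variable A : comNzRingType.

Definition invertible (a : A) : Prop := exists b, a * b = 1.

Lemma nonunit_maximal_ideal (a : A) :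
  ~ invertible a -> exists2 m : submodClosed A^o, maximal_ideal m & a \in m.
Proof.
move=> aN1.
(* The second and third conditions only exclude 1 and force a into X; allowing
   X to be empty makes the union of the empty chain admissible. *)
pose ideal (X : set A^o) := [/\ forall c x y, X x -> X y -> X (c *: x + y),
  ~ X 1 & forall x, X x -> X a].
have [F idF totF|X [[XD X1 Xa] Xmax]] := @Zorn_bigcup A^o ideal.
  split=> [c x y [X FX Xx] [Y FY Yy]|[X FX]|x [X FX Xx]].
  - have [XY|YX] := totF _ _ FX FY.
      by exists Y => //; have [YD _ _] := idF _ FY; apply: YD => //; apply: XY.
    by exists X => //; have [XD _ _] := idF _ FX; apply: XD => //; apply: YX.
  - by have [_ + _] := idF _ FX.
  - by exists X => //; have [_ _ Xa] := idF _ FX; apply: Xa Xx.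
have Xa1 : X a.
  have [[x /Xa//]|X0] := pselect (exists x, X x).
  (* An empty [X] is not maximal: the principal ideal of [a] is larger, and it is proper because [a]
     is a nonunit. *)
  have := Xmax [set a * b | b in setT]; case.
    split; first by move=> x Xx; case: X0; exists x.
    by move=> sub; apply: X0; exists (a * 1); apply: sub; exists 1.
  split=> [c _ _ [b _ <-] [d _ <-]|[b _ ab]|_ _].
  - by exists (c * b + d) => //; rewrite mulrDr; congr (_ + _); rewrite mulrCA.
  - by apply: aN1; exists b.
  - by exists 1; rewrite // mulr1.
have Xsub : submod_closed (fun x : A^o => `[< X x >] : bool).
  split=> [|c x y /asboolP Xx /asboolP Xy]; apply/asboolP; last exact: XD.
  by have := XD (-1) a a Xa1 Xa1; rewrite scaleN1r addNr.
pose m : submodClosed A^o := HB.pack (fun x : A^o => `[< X x >] : bool)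
  (GRing.isSubmodClosed.Build A A^o _ Xsub).
exists m; last exact/asboolP.
split=> [|I mI I1 x]; first by apply/negP => /asboolP.
apply/idP/idP => [Ix|/mI//]; apply/asboolP; apply: contrapT => Xx.
apply: (Xmax [set x | x \in I]).
  split; first by move=> y Xy; apply: mI; apply/asboolP.
  by move=> sub; apply: Xx; apply: sub.
split=> [c y z Iy Iz| |y _]; [|exact/negP|].
  by rewrite /= rpredD // rpredZ.
by apply: mI; apply/asboolP.
Qed.

Lemma local_ring_nonunits : local_ring A ->
  exists2 m : submodClosed A^o, 1 \notin m & forall a, ~ invertible a -> a \in m.
Proof.
move=> [m [m1 _] mP]; exists m => // a /nonunit_maximal_ideal[m' m'max am'].
by rewrite -(mP m' m'max).
Qed.

(** The determinant is a polynomial in the entries; the Leibniz products are compared one factor at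
    a time. *)
Lemma det_sub_ideal (m : submodClosed A^o) n (B C : 'M[A]_n) :
  (forall i j, B i j - C i j \in m) -> \det B - \det C \in m.
Proof.
move=> BC; rewrite /determinant -sumrB; apply: rpred_sum => s _.
rewrite -mulrBr; apply: (@rpredZ _ A^o).
elim/big_rec2: _ => [|i v u _ uv]; first by rewrite subrr rpred0.
have -> : B i (s i) * u - C i (s i) * v =
    B i (s i) * (u - v) + v * (B i (s i) - C i (s i)).
  by rewrite !mulrBr !(mulrC v) addrA subrK.
by apply: (@rpredD A^o); apply: (@rpredZ _ A^o).
Qed.

(** Modulo the ideal of nonunits the determinant of [1 - H] is 1, so it is a unit and the adjugate
    yields an inverse. *)
Lemma nonunit_mx_subr1 n (H : 'M[A]_n) : local_ring A ->
  (forall i j, ~ invertible (H i j)) -> exists N, (1%:M - H) *m N = 1%:M.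
Proof.
move=> /local_ring_nonunits[m m1 mP] HN.
have [b db] : invertible (\det (1%:M - H)).
  apply: contrapT => /mP dm; move/negP: m1; apply.
  have : \det (1%:M : 'M[A]_n) - \det (1%:M - H) \in m.
    by apply: det_sub_ideal => i j; rewrite !mxE subKr; apply: mP.
  by move=> /(@rpredD A^o _ _ _ dm); rewrite det1 addrC subrK.
by exists (b *: \adj (1%:M - H)); rewrite -scalemxAr mul_mx_adj scale_scalar_mx mulrC db.
Qed.

End LocalRing.

(** * Factoring relations through a second family *)

Section EquationalFlatness.
Variables (A : comNzRingType) (V : lmodType A).

(* The equational criterion for flatness of the quotient of V by P: a relation
   modulo P follows from the relations B C = 0 of scalars. *)
Definition flat_modulo (P : set V) : Prop :=
  forall p n (B : 'M[A]_(p, n)) (z : 'I_n -> V), (forall k, P (act B z k)) ->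
  exists r (y : 'I_r -> V) (C : 'M_(n, r)),
    (forall i, P (z i - act C y i)) /\ B *m C = 0.

Definition lin_comb n (x : 'I_n -> V) : set V :=
  [set v | exists c : 'I_n -> A, v = \sum_(i < n) c i *: x i].

(** Over a local ring this says that [x] is a minimal generating family of its span, without mention
    of the residue field. *)
Definition irredundant n (x : 'I_n -> V) : Prop :=
  forall c : 'I_n -> A, \sum_(i < n) c i *: x i = 0 ->
  forall i, ~ invertible (c i).

Lemma lin_comb_act n (x : 'I_n -> V) p (z : 'I_p -> V) :
  (forall i, lin_comb x (z i)) -> exists C : 'M[A]_(p, n), z =1 act C x.
Proof.
move=> /fin_all_exists[c zE]; exists (\matrix_(i, j) c i j) => i.
by rewrite zE; apply: eq_bigr => j _; rewrite mxE.
Qed.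

Lemma flat_modulo_all (P : set V) : (forall v, P v) -> flat_modulo P.
Proof. by move=> PT p n B z _; exists 0%N, (fun=> 0), 0; rewrite mulmx0. Qed.

Lemma relation_factor n m (x : 'I_n -> V) (y : 'I_m -> V) p (B : 'M[A]_(p, n)) :
  local_ring A -> irredundant x ->
  flat_modulo (lin_comb x) -> flat_modulo (lin_comb y) -> relation x B ->
  exists (R : 'M_(p, m)) (C : 'M_(m, n)), relation y R /\ B = R *m C.
Proof.
move=> localA irr_x flat_x flat_y xB.
have [|r [z [b [xE Bb]]]] := flat_y _ _ B x.
  by move=> k; exists (fun=> 0); rewrite xB big1 // => i _; rewrite scale0r.
have [c {}xE] := lin_comb_act xE; pose R := B *m c.
have yR : relation y R.
  move=> k; rewrite act_mulmx -(eq_act _ _ xE) actBr xB -act_mulmx Bb act0.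
  exact: subr0.
have [|r' [z' [b' [yE Rb']]]] := flat_x _ _ R y.
  by move=> k; exists (fun=> 0); rewrite yR big1 // => i _; rewrite scale0r.
(* The concatenated family collects both corrections: [d] sends it to [(1 - c c') x], which lies in
   the span of [x]. *)
have [c' {}yE] := lin_comb_act yE; pose d := row_mx b (c *m b').
have dz i : act d (catf z z') i = x i - act (c *m c') x i.
  rewrite act_row_mx !act_mulmx -(eq_act _ _ yE) actBr -xE !opprB.
  by rewrite [RHS]addrC -addrA subrK addrC.
have [|s [w [e [zE de]]]] := flat_x _ _ d (catf z z').
  move=> k; exists ((1%:M - c *m c') k).
  by rewrite -[RHS]/(act _ _ _) actBl act1 dz.
have [f {}zE] := lin_comb_act zE.
have Bd : B *m d = 0 by rewrite mul_mx_row Bb mulmxA Rb' row_mx0.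
(* The rows of [G] are relations of [x], and [B d = 0] gives [B (1 - G) = B c c' = R c']. *)
pose G := 1%:M - (c *m c' + d *m f).
have xG : relation x G.
  move=> k; rewrite /G opprD addrA 2!actBl act1 -dz act_mulmx -(eq_act _ _ zE) actBr.
  by rewrite -act_mulmx de act0 subr0 subrr.
have [N GN] : exists N, (1%:M - G) *m N = 1%:M.
  by apply: nonunit_mx_subr1 => // i j; apply: (irr_x (G i)); apply: xG.
exists R, (c' *m N); split=> //.
by rewrite -[LHS]mulmx1 -GN subKr !mulmxA mulmxDr !mulmxA Bd mul0mx addr0.
Qed.
End EquationalFlatness.

Lemma minor_ideal_irredundant (A : comNzRingType) (V : lmodType A) n m
    (x : 'I_n -> V) (y : 'I_m -> V) k a :
  local_ring A -> irredundant x ->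
  flat_modulo (lin_comb x) -> flat_modulo (lin_comb y) ->
  minor_ideal x k a -> minor_ideal y k a.
Proof.
move=> localA irr_x flat_x flat_y.
by apply: minor_ideal_factor => B; apply: relation_factor.
Qed.

(** * Minimal generators and the Fitting invariant *)

Section FittingIdeals.
Variables (A : comNzRingType) (M : lmodType A).
Hypothesis localA : local_ring A.

Lemma redundant_lin_comb n (x : 'I_n.+1 -> M) :
  ~ irredundant x -> exists i, lin_comb (x \o lift i) (x i).
Proof.
move=> /existsNP[c /not_implyP[cx /existsNP[i /contrapT[b cb]]]].
exists i, (fun l => - (b * c (lift i l))).
have /eqP := congr1 ( *:%R b) cx.
rewrite (bigD1_ord i) //= scaler0 scalerDr scalerA mulrC cb scale1r addr_eq0.
move=> /eqP ->; rewrite scaler_sumr -sumrN; apply: eq_bigr => l _.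
by rewrite scalerA scaleNr.
Qed.

Lemma generates_remove n (x : 'I_n.+1 -> M) i :
  lin_comb (x \o lift i) (x i) -> generates x -> generates (x \o lift i).
Proof.
move=> [a xi] gen_x v; have [c ->] := gen_x v.
exists (fun l => c i * a l + c (lift i l)).
rewrite (bigD1_ord i) //= xi scaler_sumr -big_split; apply: eq_bigr => l _ /=.
by rewrite scalerDl scalerA.
Qed.

Definition minimal_generators n (x : 'I_n -> M) : Prop :=
  [/\ generates x, irredundant x &
      forall m (y : 'I_m -> M), generates y -> (n <= m)%N].

(** In a family of least length no relation has a unit coefficient, since solving for that generator
    would shorten the family. *)
Lemma exists_minimal_generators : finite_module M ->
  exists n (x : 'I_n -> M), minimal_generators x.
Proof.
move=> finM.
have exP : exists n, `[< exists x : 'I_n -> M, generates x >].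
  by have [n [x gen_x]] := finM; exists n; apply/asboolP; exists x.
case: (ex_minnP exP) => n /asboolP[x gen_x] n_min.
have min_x m (y : 'I_m -> M) : generates y -> (n <= m)%N.
  by move=> gen_y; apply/n_min/asboolP; exists y.
exists n, x; split=> //; case: n x gen_x min_x {n_min} => [|n] x gen_x min_x.
  by move=> c _ [].
apply: contrapT => /redundant_lin_comb[i /generates_remove/(_ gen_x)/min_x].
by rewrite ltnn.
Qed.

(** Induction on the length of [y]. If [y] is irredundant, its relations factor through those of
    [x], flatness being trivial because [x] and [y] both generate [M]. Otherwise a generator is
    dropped, which lowers the length and the size of the minors together. *)
Lemma minor_ideal_generates n (x : 'I_n -> M) m (y : 'I_m -> M) j a :
  minimal_generators x -> generates y ->
  minor_ideal y (m - j) a -> minor_ideal x (n - j) a.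
Proof.
move=> [gen_x _ min_x]; elim: m y a => [|m IH] y a gen_y.
  move=> _; have := min_x _ _ gen_y; rewrite leqn0 => /eqP n0.
  rewrite -[a]mulr1; apply: (@in_spanZ A A^o).
  have -> : (n - j = 0)%N by rewrite n0 sub0n.
  exact: minor_ideal0.
have [irr_y|] := pselect (irredundant y).
  move=> ya; apply: (@minor_ideal_leq _ _ _ _ _ (m.+1 - j)).
    exact/leq_sub2r/(min_x _ _ gen_y).
  by apply: minor_ideal_irredundant ya => //; apply: flat_modulo_all.
move=> /redundant_lin_comb[i [c yi]].
have gen_y' : generates (y \o lift i) by apply: generates_remove => //; exists c.
case: (leqP j m) => jm.
  by rewrite subSn // => /(minor_ideal_remove yi)/(IH _ _ gen_y').
(* Both truncated differences are 0 here, and minors of size 0 generate the unit ideal. *)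
have -> : (m.+1 - j = m - j)%N.
  by lia.
move=> _; apply: (IH _ _ gen_y'); rewrite -[a]mulr1; apply: (@in_spanZ A A^o).
by rewrite (eqP (ltnW jm : (m - j == 0)%N)); exact: minor_ideal0.
Qed.

Lemma fitting_idealE n (x : 'I_n -> M) j :
  minimal_generators x -> fitting_ideal M j = minor_ideal x (n - j).
Proof.
move=> min_x; apply/seteqP; split=> a; last first.
  by have [gen_x _ _] := min_x; exists n, x.
by move=> [m [y [gen_y]]]; apply: minor_ideal_generates.
Qed.

(** The first nonzero Fitting ideal is the ideal of minors of the largest size for which it is
    nonzero. Indexing by size removes the number of generators, which may differ between the modules
    to be compared. *)
Lemma fitting_invariantE n (x : 'I_n -> M) :
  minimal_generators x -> fitting_invariant M =
  [set a | exists k, [/\ minor_ideal x k <> [set 0],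
     forall l, (k < l)%N -> minor_ideal x l = [set 0] & minor_ideal x k a]].
Proof.
move=> min_x; apply/seteqP; split=> a [].
  move=> j []; rewrite (fitting_idealE _ min_x) => j0 ltj ja.
  exists (n - j)%N; split=> // l nl.
  have [ln|nl'] := leqP l n.
    rewrite -(subKn ln) -fitting_idealE //; apply: ltj.
    by lia.
  apply/seteqP; split=> b; first exact: minor_ideal_gt.
  by move=> ->; apply: in_span0.
move=> k [k0 ltk ka]; exists (n - k)%N.
(* Minors of size beyond [n] vanish; the bound makes [n - (n - k)] equal to [k]. *)
have kn : (k <= n)%N.
  rewrite leqNgt; apply/negP => nk; apply: k0; apply/seteqP; split=> b.
    exact: minor_ideal_gt.
  by move=> ->; apply: in_span0.
split=> [|i ik|]; rewrite (fitting_idealE _ min_x) ?subKn //.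
by apply: ltk; lia.
Qed.

End FittingIdeals.

(** * The equational criterion for flatness *)

(** Stated for a bare function, since the linearity of [tens] in each argument is available only as
    a proposition. *)
Lemma linear_lin_comb (A : comNzRingType) (V W : lmodType A) (f : V -> W)
    n (c : 'I_n -> A) (x : 'I_n -> V) :
  linear f -> f (\sum_(i < n) c i *: x i) = \sum_(i < n) c i *: f (x i).
Proof.
move=> f_lin.
pose F : {linear V -> W} := HB.pack f (GRing.isLinear.Build A V W *:%R f f_lin).
by rewrite -[f]/(F : V -> W) linear_sum; apply: eq_bigr => i _; rewrite linearZ.
Qed.

Section FlatCriterion.
Variables (A : comNzRingType).

(** Let [K] be the kernel of [B] on row vectors. The quotient of [A^n] by [K] embeds in [A^p], and
    this survives tensoring with [Q]. So [B x = 0] forces the tensor of [x] to vanish, which places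
    [x] in [K Q] inside [Q^n]. *)
Lemma flat_modulo0 (Q : lmodType A) : flat Q -> flat_modulo [set 0 : Q].
Proof.
move=> flatQ p n B x Bx.
pose Kpred := fun u : 'rV[A]_n => u *m B^T == 0.
have Kclosed : submod_closed Kpred.
  split=> [|a u v /eqP uB /eqP vB]; apply/eqP; first exact: mul0mx.
  by rewrite mulmxDl -scalemxAl uB vB scaler0 addr0.
pose K : submodClosed 'rV[A]_n :=
  HB.pack Kpred (GRing.isSubmodClosed.Build A 'rV[A]_n _ Kclosed).
have f0 : {in K, forall u, mulmxr B^T u = 0} by move=> u /eqP.
pose f : {linear quotmod K -> 'rV[A]_p} := HB.pack (quotmod_lift (mulmxr B^T))
  (GRing.isLinear.Build A (quotmod K) 'rV[A]_p *:%R _ (quotmod_lift_is_linear f0)).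
have fE u : f (quotmod_pi K u) = u *m B^T := quotmod_liftE f0 u.
have f_inj : injective f.
  apply: raddf_inj => u fu; rewrite -[u]quotmod_reprK.
  have uK : quotmod_repr u \in K by rewrite -[_ \in _]/(_ == 0) -fE quotmod_reprK fu.
  by rewrite -(raddf0 (quotmod_pi K)); apply/quotmod_eq; rewrite subr0.
(* The span of [S] is [K Q]; the bilinear map [b] below induces a map from the tensor product to
   [Q^n / K Q]. *)
pose S : set {ffun 'I_n -> Q} := [set w | exists (v : 'rV[A]_n) (q : Q),
  v \in K /\ w = [ffun i => v 0 i *: q]].
pose b (v : quotmod K) (q : Q) : quotmod (Defs.span S) :=
  quotmod_pi (Defs.span S) [ffun i => quotmod_repr v 0 i *: q].
have bE u q : b (quotmod_pi K u) q = quotmod_pi (Defs.span S) [ffun i => u 0 i *: q].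
  apply/quotmod_eq/mem_span; exists (quotmod_repr (quotmod_pi K u) - u), q; split.
    by apply/quotmod_eq; rewrite quotmod_reprK.
  by apply/ffunP => i; rewrite !ffunE !mxE scalerBl.
have b_bilin : bilinear_map b.
  split=> [q a u v|u a q q'].
    rewrite -[u]quotmod_reprK -[v]quotmod_reprK -linearP !bE -linearP.
    by congr (quotmod_pi _ _); apply/ffunP => i; rewrite !ffunE !mxE scalerDl scalerA.
  rewrite /b -linearP; congr (quotmod_pi _ _); apply/ffunP => i.
  by rewrite !ffunE scalerDr !scalerA mulrC.
have [tl tr] := @tens_bilinear A (quotmod K) Q.
have [tl' tr'] := @tens_bilinear A 'rV[A]_p Q.
pose t := \sum_(i < n) tens (quotmod_pi K (delta_mx 0 i)) (x i).
have t0 : t = 0.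
  apply: (flatQ _ _ f f_inj); rewrite raddf0 raddf_sum /=.
  transitivity (\sum_(i < n) \sum_(k < p) B k i *: tens (delta_mx 0 k : 'rV[A]_p) (x i)).
    apply: eq_bigr => i _; rewrite tensor_mapE fE -rowE.
    rewrite [row i _]row_sum_delta.
    rewrite (linear_lin_comb _ _ (tl' _)); apply: eq_bigr => k _.
    by rewrite !mxE.
  rewrite exchange_big big1 // => k _ /=.
  rewrite -(linear_lin_comb _ _ (tr' _)) -/(act B x k) Bx.
  by have := tr' (delta_mx 0 k) (-1) 0 0; rewrite scaler0 addr0 scaleN1r addNr.
pose bl : {linear tensor (quotmod K) Q -> quotmod (Defs.span S)} :=
  HB.pack (tensor_lift b)
    (GRing.isLinear.Build A _ _ *:%R _ (tensor_lift_is_linear b_bilin)).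
have : [ffun i => x i] \in Defs.span S.
  rewrite -[[ffun i => x i]]subr0; apply/quotmod_eq; rewrite raddf0.
  rewrite -(raddf0 bl) -t0 raddf_sum /=.
  under eq_bigr => i _ do rewrite (tensor_liftE b_bilin) bE.
  rewrite -raddf_sum; congr (quotmod_pi _ _); apply/ffunP => j.
  rewrite !ffunE sum_ffunE (bigD1 j) //= !ffunE !mxE !eqxx scale1r big1 ?addr0 // => i ij.
  by rewrite ffunE mxE eq_sym (negPf ij) andbF scale0r.
move=> /spanP[r [c [s [sS xE]]]].
have /fin_all_exists[v /fin_all_exists[q vqP]] := sS.
(* The columns of the matrix are the vectors [c l *: v l] of [K], hence killed by [B]. *)
exists r, q, (\matrix_(i, l) (c l * v l 0 i)); split.
  move=> i; move/ffunP/(_ i): xE; rewrite ffunE => ->.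
  rewrite sum_ffunE /act -sumrB big1 // => l _.
  by have [_ ->] := vqP l; rewrite !ffunE !mxE scalerA subrr.
apply/matrixP => k l; rewrite !mxE.
have [/eqP/matrixP/(_ 0 k) + _] := vqP l; rewrite !mxE => vB.
transitivity (c l * \sum_i v l 0 i * B^T i k); last by rewrite vB mulr0.
by rewrite mulr_sumr; apply: eq_bigr => i _; rewrite !mxE mulrC mulrA.
Qed.

(* [u] and [z] give the only linear relation that [beta] has to respect for
   the defining relation [s] of the tensor product to be killed. *)
Lemma tensor_relation_witness (N Q : lmodType A) (s : {freeg (N * Q) / A}) :
  tensor_relation s -> exists (u : 'I_3 -> A) (z : 'I_3 -> Q),
  \sum_i u i *: z i = 0 /\
  forall beta : Q -> A, \sum_i u i * beta (z i) = 0 ->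
    free_lift (fun (x : N) (y : Q) => beta y *: x) s = 0.
Proof.
case=> [x x' y|x y y'|a x y|a x y].
(* Relations in the first factor are killed for every [beta], so the zero relation serves; those in
   the second factor impose one equation on [beta], padded to three terms where necessary. *)
- exists (fun=> 0), (fun=> 0); split=> [|beta _].
    by rewrite big1 // => i _; rewrite scaler0.
  by rewrite !raddfB /= !free_liftU !scale1r scalerDr -addrA -opprD subrr.
- exists (tnth [tuple 1; -1; -1]), (tnth [tuple y + y'; y; y']).
  split=> [|beta]; rewrite !big_ord_recl big_ord0 /= !(tnth_nth 0) /=.
    by rewrite !scale1r !scaleN1r addr0 -opprD subrr.
  rewrite mul1r !mulN1r addr0 -opprD => /eqP; rewrite subr_eq0 => /eqP b0.
  by rewrite !raddfB /= !free_liftU !scale1r b0 scalerDl -addrA -opprD subrr.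
- exists (fun=> 0), (fun=> 0); split=> [|beta _].
    by rewrite big1 // => i _; rewrite scaler0.
  rewrite !raddfB /= [free_lift _ (_ *: _)]linearZ /= !free_liftU !scale1r.
  by rewrite !scalerA mulrC subrr.
- exists (tnth [tuple 1; -a; 0]), (tnth [tuple a *: y; y; 0]).
  split=> [|beta]; rewrite !big_ord_recl big_ord0 /= !(tnth_nth 0) /=.
    by rewrite scale1r scaler0 !addr0 scaleNr subrr.
  rewrite mul1r mul0r !addr0 mulNr => /eqP; rewrite subr_eq0 => /eqP b0.
  rewrite !raddfB /= [free_lift _ (_ *: _)]linearZ /= !free_liftU !scale1r.
  by rewrite b0 scalerA subrr.
Qed.

Lemma tensor_sum (N Q : lmodType A) (t : tensor N Q) :
  exists n (x : 'I_n -> N) (y : 'I_n -> Q), t = \sum_i tens (x i) (y i).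
Proof.
pose D := quotmod_repr t; pose s := in_tuple (dom D).
exists (size (dom D)), (fun i => coeff (tnth s i) D *: (tnth s i).1).
exists (fun i => (tnth s i).2); rewrite -[LHS]quotmod_reprK -/D.
rewrite -{1}(freeg_sumE D) raddf_sum big_tnth; apply: eq_bigr => i _ /=.
rewrite -/s; case: (tnth s i) => x y /=.
have [tl _] := @tens_bilinear A N Q.
have := tl y (coeff (x, y) D) x 0; rewrite addr0 => ->.
have -> : tens 0 y = 0 :> tensor N Q.
  by have := tl y (-1) 0 0; rewrite scaler0 addr0 scaleN1r addNr.
rewrite addr0 /tens -linearZ /=; congr (quotmod_pi _ _).
by apply/eqP/freeg_eqP => z; rewrite coeffZ !coeffU mul1r.
Qed.

(** If the sum of the [f (x i) ⊗ y i] vanishes, finitely many defining relations witness it,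
    involving finitely many elements of [Q]. The criterion writes these as combinations of new
    elements [w j] compatibly with the relations; the coefficient of each [w j] is then a
    combination of the [x i] killed by [f], hence zero. *)
Lemma flat_modulo_flat (Q : lmodType A) : flat_modulo [set 0 : Q] -> flat Q.
Proof.
move=> flatQ N N' f f_inj; apply: raddf_inj => t.
have [n [x [y ->]]] := tensor_sum t => {t}; rewrite raddf_sum /=.
under eq_bigr => i _ do rewrite tensor_mapE.
rewrite -raddf_sum -[RHS](raddf0 (quotmod_pi _)) => /quotmod_eq.
rewrite subr0 => /spanP[L [c [s [sS DE]]]].
have /fin_all_exists[u /fin_all_exists[z uzP]] l := tensor_relation_witness (sS l).
(* [E] lists without repetition the elements of [Q] that occur, so that functions on them can be
   defined by indices. *)
pose E := undup (codom y ++ flatten [seq codom (z l) | l : 'I_L]).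
pose e := tnth (in_tuple E).
have e_inj : injective e by apply/tuple_uniqP/undup_uniq.
have eq_e t0 t : (e t == e t0) = (t == t0) by apply: inj_eq.
have y_e i : exists t, y i = e t.
  by apply/tnthP; rewrite mem_undup mem_cat codom_f.
have z_e l i : exists t, z l i = e t.
  apply/tnthP; rewrite mem_undup mem_cat; apply/orP; right.
  by apply/flatten_mapP; exists l; rewrite ?mem_enum ?codom_f.
pose B := \matrix_(l < L, t < size E) \sum_i u l i * (e t == z l i)%:R.
have [|r [w [C [eC BC]]]] := flatQ _ _ B e.
  move=> l; apply: etrans (proj1 (uzP l)); rewrite /act.
  under eq_bigr => t _ do rewrite mxE scaler_suml.
  rewrite exchange_big /=; apply: eq_bigr => i _; have [t0 ->] := z_e l i.
  rewrite (bigD1 t0) //= eqxx mulr1 big1 ?addr0 // => t /negPf tt0.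
  by rewrite eq_e tt0 mulr0 scale0r.
(* Column [j] of [C] as a function on [Q], with value 0 outside [E]; [B C = 0] says that it respects
   the witnessing relations. *)
pose beta j q := \sum_t C t j * (e t == q)%:R.
have beta_e j t0 : beta j (e t0) = C t0 j.
  rewrite /beta (bigD1 t0) //= eqxx mulr1 big1 ?addr0 // => t /negPf tt0.
  by rewrite eq_e tt0 mulr0.
have yE i : y i = \sum_j beta j (y i) *: w j.
  have [t0 ->] := y_e i; move: (eC t0) => /eqP; rewrite subr_eq0 => /eqP {1}->.
  by apply: eq_bigr => j _; rewrite beta_e.
have beta_x j : \sum_i beta j (y i) *: x i = 0.
  apply: f_inj; rewrite raddf0 linear_sum.
  transitivity (free_lift (fun (v : N') (q : Q) => beta j q *: v)
    (\sum_i << (f (x i), y i) >>)).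
    by rewrite raddf_sum; apply: eq_bigr => i _; rewrite linearZ /= free_liftU scale1r.
  rewrite DE raddf_sum big1 // => l _; rewrite /= [free_lift _ _]linearZ /=.
  have [_ ->] := uzP l; first exact: scaler0.
  apply: (@etrans _ _ ((B *m C) l j)); last by rewrite BC mxE.
  rewrite mxE.
  under eq_bigr => i _ do rewrite mulr_sumr.
  rewrite exchange_big; apply: eq_bigr => t _ /=.
  rewrite mxE mulr_suml; apply: eq_bigr => i _.
  by rewrite mulrA mulrAC.
have [tl tr] := @tens_bilinear A N Q.
transitivity (\sum_i \sum_j beta j (y i) *: tens (x i) (w j)).
  by apply: eq_bigr => i _; rewrite {1}yE (linear_lin_comb _ _ (tr _)).
rewrite exchange_big big1 // => j _ /=.
rewrite -(linear_lin_comb _ _ (tl _)) beta_x.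
by have := tl (w j) (-1) 0 0; rewrite scaler0 addr0 scaleN1r addNr.
Qed.

Lemma flat_modulo_quotmod (V : lmodType A) (M : submodClosed V) :
  flat_modulo [set 0 : quotmod M] <-> flat_modulo [set v | v \in M].
Proof.
have piM v : quotmod_pi M v = 0 <-> v \in M.
  by rewrite -[v in v \in M]subr0 -quotmod_eq raddf0.
have piact p n (B : 'M[A]_(p, n)) (z : 'I_n -> V) k :
    quotmod_pi M (act B z k) = act B (quotmod_pi M \o z) k.
  exact: act_linear.
split=> flatM p n B z zB.
  have [|r [y [C [zE BC]]]] := flatM p n B (quotmod_pi M \o z).
    by move=> k; rewrite -piact; apply/piM/zB.
  exists r, (@quotmod_repr _ _ M \o y), C; split=> // i; apply/piM.
  rewrite raddfB /= piact -[RHS](zE i); congr (_ - _).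
  by apply: eq_act => j; apply: quotmod_reprK.
have zK : quotmod_pi M \o (@quotmod_repr _ _ M \o z) =1 z.
  by move=> i; apply: quotmod_reprK.
have [|r [y [C [zE BC]]]] := flatM p n B (@quotmod_repr _ _ M \o z).
  by move=> k; apply/piM; rewrite piact (eq_act _ _ zK); apply: zB.
exists r, (quotmod_pi M \o y), C; split=> // i.
by rewrite -piact -[z i]zK -raddfB; apply/piM; apply: zE.
Qed.

Lemma flat_quotmodP (V : lmodType A) (M : submodClosed V) :
  flat (quotmod M) <-> flat_modulo [set v | v \in M].
Proof.
by rewrite -flat_modulo_quotmod; split; [apply: flat_modulo0 | apply: flat_modulo_flat].
Qed.

End FlatCriterion.

(** * Transfer along injections with flat cokernel *)

Section Transfer.
Variables (A : comNzRingType).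

Lemma image_val_lin_comb (V W : lmodType A) (f : {linear V -> W})
    (M : submodClosed V) n (c : 'I_n -> A) (x : 'I_n -> submod M) :
  f (val (\sum_(i < n) c i *: x i)) = \sum_(i < n) c i *: f (val (x i)).
Proof. by rewrite !raddf_sum; apply: eq_bigr => i _; rewrite /= !linearZ. Qed.

Section Image.
Variables (V W : lmodType A) (f : {linear V -> W}).

(** Flatness passes to extensions: the system is first solved modulo the range of [f], the remainder
    is pulled back to [V] and solved modulo [P], and the two solutions are concatenated. *)
Lemma flat_modulo_image (P : set V) : injective f ->
  flat_modulo P -> flat_modulo (range f) -> flat_modulo [set f v | v in P].
Proof.
move=> f_inj flatP flatf p n B z zP.
have [|r [y [C [yE BC]]]] := flatf p n B z.
  by move=> k; have [v _ <-] := zP k; exists v.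
have /fin_all_exists2[u _ uE] := yE.
have [|r' [y' [C' [uP BC']]]] := flatP p n B u.
  move=> k; have [v Pv vE] := zP k; rewrite (_ : act B u k = v) //.
  apply: f_inj; rewrite (act_linear f) vE (eq_act _ _ uE) actBr.
  by rewrite -act_mulmx BC act0 subr0.
exists (r + r')%N, (catf y (f \o y')), (row_mx C C'); split; last first.
  by rewrite mul_mx_row BC BC' row_mx0.
move=> i; exists (u i - act C' y' i) => //.
by rewrite raddfB /= uE act_row_mx (act_linear f) opprD addrA.
Qed.

Lemma relation_image n (x : 'I_n -> V) p (B : 'M[A]_(p, n)) :
  injective f -> relation (f \o x) B <-> relation x B.
Proof.
move=> f_inj; split=> xB k; last by rewrite -act_linear xB raddf0.
by apply: f_inj; rewrite act_linear xB raddf0.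
Qed.

Lemma minor_ideal_image n (x : 'I_n -> V) k :
  injective f -> minor_ideal (f \o x) k = minor_ideal x k.
Proof.
move=> f_inj; congr in_span; apply/seteqP.
by split=> a [B [g [xB ->]]]; exists B, g; split=> //; apply/(relation_image x B f_inj).
Qed.

Lemma irredundant_image n (x : 'I_n -> V) :
  injective f -> irredundant x -> irredundant (f \o x).
Proof.
move=> f_inj irr_x c cx; apply: irr_x; apply: f_inj.
by rewrite raddf0 -cx linear_sum; apply: eq_bigr => i _; rewrite linearZ.
Qed.

Variable M : submodClosed V.

Definition submod_image : {pred W} := fun w => `[< exists2 v, v \in M & f v = w >].

Lemma submod_image_closed : submod_closed submod_image.
Proof.
split=> [|a _ _ /asboolP[u Mu <-] /asboolP[v Mv <-]]; apply/asboolP.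
  by exists 0; rewrite ?raddf0 ?rpred0.
by exists (a *: u + v); rewrite ?linearP // rpredD // rpredZ.
Qed.

HB.instance Definition _ :=
  GRing.isSubmodClosed.Build A W submod_image submod_image_closed.

Lemma finite_with_flat_quotient_image : injective f -> flat_modulo (range f) ->
  finite_with_flat_quotient M ->
  finite_with_flat_quotient (submod_image : submodClosed W).
Proof.
move=> f_inj flatf [[n [x gen_x]] /flat_quotmodP flatM]; split; last first.
  apply/flat_quotmodP; rewrite (_ : [set v | _] = [set f v | v in [set v | v \in M]]).
    exact: flat_modulo_image.
  by apply/seteqP; split=> w /asboolP.
have fx i : f (val (x i)) \in submod_image.
  by apply/asboolP; exists (val (x i)); first exact: valP.
exists n, (fun i => Submod (fx i)) => -[w wM]; have /asboolP[v Mv vw] := wM.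
have [c cE] := gen_x (Submod Mv); exists c; apply: val_inj.
apply: etrans (esym (image_val_lin_comb (idfun : {linear W -> W}) _ _)) => /=.
by rewrite -vw -[v]/(val (Submod Mv)) cE image_val_lin_comb.
Qed.

End Image.

Lemma finite_by_flat_image (V W : lmodType A) (f : {linear V -> W}) :
  injective f -> flat_modulo (range f) -> finite_by_flat V -> finite_by_flat W.
Proof.
move=> f_inj flatf [M finM]; exists (submod_image f M : submodClosed W).
exact: finite_with_flat_quotient_image.
Qed.

Lemma lin_comb_generates (V W : lmodType A) (f : {linear V -> W})
    (M : submodClosed V) n (x : 'I_n -> submod M) :
  generates x -> lin_comb (f \o val \o x) = [set f v | v in [set v | v \in M]].
Proof.
move=> gen_x; apply/seteqP; split=> [w [c ->]|_ [v Mv <-]].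
  exists (val (\sum_(i < n) c i *: x i)); first exact: valP.
  exact: image_val_lin_comb.
have [c cE] := gen_x (Submod Mv); exists c.
by rewrite -[v]/(val (Submod Mv)) cE image_val_lin_comb.
Qed.

(** Inside [W] both submodules have flat quotients. Injections preserve relations, so minimal
    generators of the two can be compared there, in both directions. *)
Lemma fitting_invariant_unique (U V W : lmodType A)
    (f : {linear U -> W}) (g : {linear V -> W})
    (M : submodClosed U) (M' : submodClosed V) :
  local_ring A -> injective f -> injective g ->
  flat_modulo (range f) -> flat_modulo (range g) ->
  finite_with_flat_quotient M -> finite_with_flat_quotient M' ->
  fitting_invariant (submod M) = fitting_invariant (submod M').
Proof.
move=> localA f_inj g_inj flatf flatg.
move=> [finM /flat_quotmodP flatM] [finM' /flat_quotmodP flatM'].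
have [n [x min_x]] := exists_minimal_generators finM.
have [m [y min_y]] := exists_minimal_generators finM'.
rewrite (fitting_invariantE localA min_x) (fitting_invariantE localA min_y).
suff -> : minor_ideal x = minor_ideal y by [].
have [gen_x irr_x _] := min_x; have [gen_y irr_y _] := min_y.
have fx_inj : injective (f \o val : submod M -> W) by move=> u v /f_inj/val_inj.
have gy_inj : injective (g \o val : submod M' -> W) by move=> u v /g_inj/val_inj.
have flat_x : flat_modulo (lin_comb (f \o val \o x)).
  by rewrite lin_comb_generates //; apply: flat_modulo_image.
have flat_y : flat_modulo (lin_comb (g \o val \o y)).
  by rewrite lin_comb_generates //; apply: flat_modulo_image.
apply/funext => k; apply/seteqP.
rewrite -(minor_ideal_image x k fx_inj) -(minor_ideal_image y k gy_inj).
by split=> a; apply: minor_ideal_irredundant => //; apply: irredundant_image.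
Qed.

Lemma fbf_fitting_invariant_unique (U V W : lmodType A)
    (f : {linear U -> W}) (g : {linear V -> W}) (I J : set A) :
  local_ring A -> injective f -> injective g ->
  flat_modulo (range f) -> flat_modulo (range g) ->
  fbf_fitting_invariant U I -> fbf_fitting_invariant V J -> I = J.
Proof.
move=> localA f_inj g_inj flatf flatg [M finM ->] [M' finM' ->].
exact: (fitting_invariant_unique localA f_inj g_inj).
Qed.

End Transfer.

(** * Direct sums with a flat module *)

Section Products.
Variables (A : comNzRingType) (X Y C : lmodType A).

Definition prod_inl (x : X) : X * C := (x, 0).

Lemma prod_inl_is_linear : linear prod_inl.
Proof. by move=> a x y; apply/pair_equal_spec; rewrite /= scaler0 addr0. Qed.

HB.instance Definition _ :=
  GRing.isLinear.Build A X (X * C)%type *:%R prod_inl prod_inl_is_linear.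

Lemma prod_inl_inj : injective prod_inl.
Proof. by move=> x y []. Qed.

(** The cokernel is [C]: the system is solved in the second component and lifted with first
    component 0. *)
Lemma flat_modulo_prod_inl : flat C -> flat_modulo (range prod_inl).
Proof.
move=> /flat_modulo0 flatC p n B z zB.
have [|r [w [D [zE BD]]]] := flatC p n B (snd \o z).
  move=> k; have [x _ xE] := zB k; rewrite -(act_linear (snd : {linear (X * C)%type -> C})).
  by rewrite -xE.
exists r, (fun j => (0, w j)), D; split=> // i.
exists ((z i - act D (fun j => (0, w j)) i).1) => //.
rewrite /prod_inl -(zE i) [RHS]surjective_pairing; congr pair.
by rewrite [RHS]raddfB /= (act_linear (snd : {linear (X * C)%type -> C})).
Qed.

Variable f : {linear X -> Y}.

Definition prod_mapl (u : X * C) : Y * C := (f u.1, u.2).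

Lemma prod_mapl_is_linear : linear prod_mapl.
Proof. by move=> a u v; apply/pair_equal_spec; rewrite /= linearP. Qed.

HB.instance Definition _ :=
  GRing.isLinear.Build A (X * C)%type (Y * C)%type *:%R prod_mapl prod_mapl_is_linear.

Lemma prod_mapl_inj : injective f -> injective prod_mapl.
Proof. by move=> f_inj [x c] [y d] [/f_inj -> ->]. Qed.

(** The cokernel is that of [f]: only the first component has to be solved, as the range contains
    every second component. *)
Lemma flat_modulo_prod_mapl : flat_modulo (range f) -> flat_modulo (range prod_mapl).
Proof.
move=> flatf p n B z zB.
have [|r [w [D [zE BD]]]] := flatf p n B (fst \o z).
  move=> k; have [x _ xE] := zB k; rewrite -(act_linear (fst : {linear (Y * C)%type -> Y})).
  by rewrite -xE; exists x.1.
exists r, (fun j => (w j, 0)), D; split=> // i; have [x _ xE] := zE i.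
exists (x, (z i).2) => //; rewrite /prod_mapl /= xE [RHS]surjective_pairing.
congr pair; rewrite [RHS]raddfB /=.
  by rewrite (act_linear (fst : {linear (Y * C)%type -> Y})).
by rewrite (act_linear (snd : {linear (Y * C)%type -> C})) act0r subr0.
Qed.

End Products.

Lemma fbf_fitting_invariant_image (A : comNzRingType) (V W : lmodType A)
    (f : {linear V -> W}) (I : set A) :
  local_ring A -> injective f -> flat_modulo (range f) ->
  fbf_fitting_invariant V I -> fbf_fitting_invariant W I.
Proof.
move=> localA f_inj flatf [M finM ->].
have finfM := finite_with_flat_quotient_image f_inj flatf finM.
exists (submod_image f M : submodClosed W) => //.
apply: (@fitting_invariant_unique _ _ _ _ f idfun) => //.
by apply: flat_modulo_all => v; exists v.
Qed.

Lemma prod_fitting_invariant_unique (A : comNzRingType) (X C D : lmodType A)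
    (I J : set A) :
  local_ring A -> flat C -> flat D ->
  fbf_fitting_invariant (X * C)%type I -> fbf_fitting_invariant (X * D)%type J ->
  I = J.
Proof.
move=> localA flatC flatD.
(* Both modules embed in [(X * C) * D], with cokernels [D] and [C]. *)
apply: (@fbf_fitting_invariant_unique _ _ _ _ (@prod_inl A (X * C)%type D)
  (@prod_mapl A _ _ D (@prod_inl A X C))) => //.
- exact: prod_inl_inj.
- exact/prod_mapl_inj/prod_inl_inj.
- exact: flat_modulo_prod_inl.
- exact/flat_modulo_prod_mapl/flat_modulo_prod_inl.
Qed.

Theorem lemma12p7 (A : comNzRingType)
    (noethA : noetherian A) (localA : local_ring A) :
  (* (i) *)
  ((forall (X : lmodType A) (M M' : submodClosed X),
      finite_module (submod M) -> finite_module (submod M') ->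
      flat (quotmod M) -> flat (quotmod M') ->
      fitting_invariant (submod M) = fitting_invariant (submod M'))
   /\
   (forall X C D : lmodType A,
      flat C -> flat D ->
      finite_by_flat (X * C)%type -> finite_by_flat (X * D)%type ->
      forall I J : set A,
        fbf_fitting_invariant (X * C)%type I ->
        fbf_fitting_invariant (X * D)%type J -> I = J))
  /\
  (* (ii) *)
  (forall (Y : lmodType A) (X : submodClosed Y),
     flat (quotmod X) ->
     (finite_by_flat (submod X) ->
        finite_by_flat Y /\
        forall I J : set A,
          fbf_fitting_invariant (submod X) I ->
          fbf_fitting_invariant Y J -> I = J)
     /\
     (pseudo_finite_by_flat (submod X) ->
        pseudo_finite_by_flat Y /\
        forall I J : set A,
          pfbf_fitting_invariant (submod X) I ->
          pfbf_fitting_invariant Y J -> I = J)).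
Proof.
have id_flat (V : lmodType A) : flat_modulo (range (idfun : V -> V)).
  by apply: flat_modulo_all => v; exists v.
split; [split|].
- move=> X M M' finM finM' flatM flatM'.
  exact: (@fitting_invariant_unique _ _ _ _ idfun idfun).
- move=> X C D flatC flatD _ _ I J; exact: prod_fitting_invariant_unique.
move=> Y X /flat_quotmodP flatX.
pose val_lin : {linear submod X -> Y} := val.
have val_inj' : injective val_lin := val_inj.
have val_flat : flat_modulo (range val_lin).
  rewrite (_ : range _ = [set v | v \in X]) //; apply/seteqP; split=> [_ [u _ <-]|v Xv].
    exact: valP.
  by exists (Submod Xv).
split.
  move=> fbfX; split; first exact: (finite_by_flat_image val_inj' val_flat).
  move=> I J.
  exact: (@fbf_fitting_invariant_unique _ _ _ _ val_lin idfun).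
have mapl_inj C := @prod_mapl_inj _ _ _ C _ val_inj'.
have mapl_flat C := @flat_modulo_prod_mapl _ _ _ C _ val_flat.
move=> [C flatC fbfXC]; split.
  by exists C => //; apply: (finite_by_flat_image (mapl_inj C) (mapl_flat C)).
move=> I J [C1 flatC1 XI] [C2 flatC2 YJ].
(* [C1] and [C2] may differ: the invariant is first carried from [X * C1] to [Y * C1], then compared
   with that of [Y * C2]. *)
apply: (prod_fitting_invariant_unique localA flatC1 flatC2 _ YJ).
exact: (fbf_fitting_invariant_image localA (mapl_inj C1) (mapl_flat C1)).
Qed.
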